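(* Let $F=\frac1n\sum_{i=1}^nF_i$ be monotone and $\ell$-star-cocoercive. Let $\mathcal{C}\subset\mathbb{R}^d$ be a compact convex set with $X^*\subset\mathcal{C}$ and diameter $\Omega_{\mathcal{C}}=\max_{x,y\in\mathcal{C}}\|x-y\|$. Assume that there is $\widehat\ell>0$ such that for all $x\in\mathbb{R}^d$, with $x^*=\mathrm{proj}_{X^*}(x)$, $$\frac1n\sum_{i=1}^n\|F_i(x)-F_i(x^* )\|^2\le\widehat\ell\,\langle F(x)-F(x^* ),x-x^*\rangle,$$ that $X^*=\{x^*\}$ is a singleton, and that $0<\gamma\le\frac1{6\widehat\ell}$. Then for all $K\ge1$ the iterates produced by SAGA-SGDA satisfy $$\begin{aligned}\mathbb{E}\left[\mathrm{Gap}_{\mathcal{C}}\left(\frac1K\sum_{k=1}^Kx^k\right)\right]\le\ &\frac{3\max_{u\in\mathcal{C}}\|x^0-u\|^2}{2\gamma K}+\frac{8\gamma\ell^2\Omega_{\mathcal{C}}^2}{K}+\frac{(12\widehat\ell+\ell)\|x^0-x^{*,0}\|^2}{K}\\&+\left(4+(12\widehat\ell+\ell)\gamma\right)\frac{2n\gamma\sigma_0^2}{K}+9\gamma\max_{x^*\in X^*}\|F(x^* )\|^2,\end{aligned}$$ where $\sigma_0^2=\frac1n\sum_{i=1}^n\|F_i(w_i^0)-F_i(x^* )\|^2$.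
   Context: Norms and inner products on $\mathbb{R}^d$ are Euclidean. $F,F_1,\dots,F_n:\mathbb{R}^d\to\mathbb{R}^d$ are operators and $R:\mathbb{R}^d\to\mathbb{R}\cup\{+\infty\}$ is a proper lower semicontinuous convex function. $X^*$ is the (nonempty) set of solutions of the regularized variational inequality: find $x^*\in\mathbb{R}^d$ with $\langle F(x^* ),x-x^*\rangle+R(x)-R(x^* )\ge0$ for all $x\in\mathbb{R}^d$. $\mathrm{proj}_{X^*}(x)=\arg\min_{y\in X^*}\|y-x\|$, and $x^{*,0}=\mathrm{proj}_{X^*}(x^0)$. $F$ is monotone if $\langle F(x)-F(y),x-y\rangle\ge0$ for all $x,y$. $F$ is $\ell$-star-cocoercive ($\ell>0$) if $\|F(x)-F(x^* )\|^2\le\ell\langle F(x)-F(x^* ),x-x^*\rangle$ for all $x$, where $x^*=\mathrm{proj}_{X^*}(x)$. Restricted gap function: $\mathrm{Gap}_{\mathcal{C}}(z)=\max_{u\in\mathcal{C}}[\langle F(u),z-u\rangle+R(z)-R(u)]$ (maximum understood as supremum). SAGA-SGDA, with deterministic $x^0\in\mathbb{R}^d$ and $w_i^0=x^0$ for all $i$: at each iteration $k\ge0$ draw $j_k$ uniformly from $\{1,\dots,n\}$ (independently of the past), set $g^k=F_{j_k}(x^k)-F_{j_k}(w_{j_k}^k)+\frac1n\sum_{i=1}^nF_i(w_i^k)$, $w_{j_k}^{k+1}=x^k$, $w_i^{k+1}=w_i^k$ for $i\ne j_k$, and $x^{k+1}=\mathrm{prox}_{\gamma R}(x^k-\gamma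 g^k)$, where $\mathrm{prox}_{\gamma R}(x)=\arg\min_{y}\{R(y)+\|y-x\|^2/(2\gamma)\}$. *)

(* Defs.v *)
From HB Require Import structures.
From mathcomp Require Import all_boot all_order all_algebra.
From mathcomp Require Import all_classical all_reals all_analysis.

Set Implicit Arguments.
Unset Strict Implicit.
Unset Printing Implicit Defensive.

Import Order.TTheory GRing.Theory Num.Theory.
Import numFieldNormedType.Exports.
Local Open Scope classical_set_scope.
Local Open Scope ring_scope.

(* The canonical norm of MathComp-Analysis on row vectors is the max norm; it
   induces the same topology as the Euclidean norm below, so that the library's
   [compact] and [lower_semicontinuous] can be used unchanged. *)
Definition inner (R : realType) (d : nat) (u v : 'rV[R]_d) : R :=
  \sum_(i < d) u 0 i * v 0 i.

Definition enorm (R : realType) (d : nat) (u : 'rV[R]_d) : R :=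
  Num.sqrt (inner u u).

(* The (possibly empty) set of all minimizers of [f] over [A]. Stating that a
   point belongs to it renders "y = argmin". *)
Definition argmin_on (U : Type) (disp : Order.disp_t) (V : porderType disp)
    (A : set U) (f : U -> V) : set U :=
  [set y | A y /\ forall z, A z -> (f y <= f z)%O].

Definition proj_on (R : realType) (d : nat) (A : set 'rV[R]_d) (x : 'rV[R]_d) :
    set 'rV[R]_d :=
  argmin_on A (fun y => enorm (y - x)).

Definition prox (R : realType) (d : nat) (gamma : R) (r : 'rV[R]_d -> \bar R)
    (x : 'rV[R]_d) : set 'rV[R]_d :=
  argmin_on setT (fun y => (r y + (enorm (y - x) ^+ 2 / (2 * gamma))%:E)%E).

(* Regularizers with values in R \cup {+oo}. *)
Definition proper_reg (R : realType) (U : Type) (r : U -> \bar R) : Prop :=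
  (forall x, r x != -oo%E) /\ (exists x, r x != +oo%E).

(* [convex_function] of the library only covers real-valued functions. Since
   [0 * +oo = 0] in [\bar R], the end points of [0, 1] are harmless. *)
Definition econvex (R : realType) (d : nat) (r : 'rV[R]_d -> \bar R) : Prop :=
  forall (x y : 'rV[R]_d) (t : R), 0 <= t <= 1 ->
    (r ((t *: x + (1 - t) *: y)%R) <= t%:E * r x + (1 - t)%:E * r y)%E.

(* In [\bar R], [+oo - +oo = -oo]; hence a solution xs of the variational
   inequality with a proper [r] satisfies r xs < +oo. *)
Definition vi_solutions (R : realType) (d : nat) (F : 'rV[R]_d -> 'rV[R]_d)
    (r : 'rV[R]_d -> \bar R) : set 'rV[R]_d :=
  [set xs | forall x, (0 <= (inner (F xs) (x - xs))%:E + r x - r xs)%E].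

Definition monotone_op (R : realType) (d : nat) (F : 'rV[R]_d -> 'rV[R]_d) :
    Prop :=
  forall x y, 0 <= inner (F x - F y) (x - y).

Definition star_cocoercive (R : realType) (d : nat) (l : R)
    (Xs : set 'rV[R]_d) (F : 'rV[R]_d -> 'rV[R]_d) : Prop :=
  0 < l /\
  forall x xs, proj_on Xs x xs ->
    enorm (F x - F xs) ^+ 2 <= l * inner (F x - F xs) (x - xs).

Definition gap (R : realType) (d : nat) (F : 'rV[R]_d -> 'rV[R]_d)
    (r : 'rV[R]_d -> \bar R) (C : set 'rV[R]_d) (z : 'rV[R]_d) : \bar R :=
  ereal_sup [set ((inner (F u) (z - u))%:E + r z - r u)%E | u in C].

Definition diameter (R : realType) (d : nat) (C : set 'rV[R]_d) : R :=
  sup [set enorm (x - y) | x in C & y in C].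

Definition average_op (R : realType) (d n : nat)
    (Fi : 'I_n -> 'rV[R]_d -> 'rV[R]_d) (x : 'rV[R]_d) : 'rV[R]_d :=
  n%:R^-1 *: \sum_(i < n) Fi i x.

Definition saga_estimator (R : realType) (d n : nat)
    (Fi : 'I_n -> 'rV[R]_d -> 'rV[R]_d) (x : 'rV[R]_d)
    (w : 'I_n -> 'rV[R]_d) (j : 'I_n) : 'rV[R]_d :=
  Fi j x - Fi j (w j) + n%:R^-1 *: \sum_(i < n) Fi i (w i).

(* One trajectory: [j k] is the index drawn at iteration k. *)
Record saga_sgda (R : realType) (d n : nat)
    (Fi : 'I_n -> 'rV[R]_d -> 'rV[R]_d) (r : 'rV[R]_d -> \bar R) (gamma : R)
    (x0 : 'rV[R]_d) (w0 : 'I_n -> 'rV[R]_d) (j : nat -> 'I_n)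
    (x : nat -> 'rV[R]_d) (w : nat -> 'I_n -> 'rV[R]_d) : Prop := SagaSgda {
  saga_x0 : x 0%N = x0;
  saga_w0 : forall i, w 0%N i = w0 i;
  saga_wS : forall k i, w k.+1 i = if i == j k then x k else w k i;
  saga_xS : forall k,
    prox gamma r (x k - gamma *: saga_estimator Fi (x k) (w k) (j k)) (x k.+1)
}.

Definition sigma2 (R : realType) (d n : nat)
    (Fi : 'I_n -> 'rV[R]_d -> 'rV[R]_d) (w : 'I_n -> 'rV[R]_d)
    (xs : 'rV[R]_d) : R :=
  n%:R^-1 * \sum_(i < n) enorm (Fi i (w i) - Fi i xs) ^+ 2.

(* Independent uniform draws from the n indices. Taking [A k = setT] for some
   k, the product rule over initial segments gives the one over every finite
   subfamily. *)
Record iid_uniform (disp : measure_display) (T : measurableType disp)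
    (R : realType) (P : probability T R) (n : nat) (j : nat -> T -> 'I_n) :
    Prop := IidUniform {
  iid_measurable : forall k (A : set 'I_n), measurable (j k @^-1` A);
  iid_uniform_law : forall k i, P (j k @^-1` [set i]) = (n%:R^-1)%:E;
  iid_independent : forall (K : nat) (A : nat -> set 'I_n),
    P [set om | forall k, (k < K)%N -> A k (j k om)] =
    (\prod_(k < K) P (j k @^-1` A k))%E
}.

(* Main.v *)
Require Import Defs.
From HB Require Import structures.
From mathcomp Require Import all_boot all_order all_algebra.
From mathcomp Require Import all_classical all_reals all_analysis.
From mathcomp Require Import ring lra.

Import Order.TTheory GRing.Theory Num.Theory.
Import numFieldNormedType.Exports.
Local Open Scope classical_set_scope.
Local Open Scope ring_scope.

(** The proximal step satisfies, for every [u] in the domain of [r],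
    [2 gamma (<g, x' - u> + r x' - r u) <= |x - u|^2 - |x' - u|^2 - |x' - x|^2].
    Taking [u = xs], averaging, and combining with the decrease of
    [sigma_k^2 = sigma2 Fi w_k xs] bounds the sum over [k] of the correlations
    [<F x_k - F xs, x_k - xs>], hence that of [E |g_k - F xs|^2].
    For a general [u] the inequality telescopes, up to the noise
    [g_k - F x_k]. The part of the noise that depends on [u] enters only through
    [<sum_k (g_k - F x_k), x0 - u>], which Young's inequality bounds by
    [|x0 - u|^2 / 2 + |sum_k (g_k - F x_k)|^2 / 2]; thus the supremum over [u] is
    bounded before taking expectations, and the last norm is controlled by the
    orthogonality of the martingale increments.

    As the proximal point is unique, the iterates up to time [K] are functions
    of the first [K] draws, so that all expectations are averages over the
    finite set ['I_n ^ K] of histories. *)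

(** * Bilinear algebra of the Euclidean inner product *)

Section Inner.
Context {R : realType} {d : nat}.
Implicit Types u v w : 'rV[R]_d.

Lemma innerC u v : inner u v = inner v u.
Proof. by apply: eq_bigr => i _; rewrite mulrC. Qed.

Lemma innerDl u v w : inner (u + v) w = inner u w + inner v w.
Proof. by rewrite -big_split; apply: eq_bigr => i _; rewrite mxE mulrDl. Qed.

Lemma innerZl (a : R) u v : inner (a *: u) v = a * inner u v.
Proof. by rewrite /inner mulr_sumr; apply: eq_bigr => i _; rewrite mxE mulrA. Qed.

Lemma innerNl u v : inner (- u) v = - inner u v.
Proof. by rewrite -scaleN1r innerZl mulN1r. Qed.

Lemma innerDr u v w : inner w (u + v) = inner w u + inner w v.
Proof. by rewrite innerC innerDl !(innerC w). Qed.

Lemma innerZr (a : R) u v : inner u (a *: v) = a * inner u v.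
Proof. by rewrite innerC innerZl innerC. Qed.

Lemma innerNr u v : inner u (- v) = - inner u v.
Proof. by rewrite innerC innerNl innerC. Qed.

Lemma inner0l v : inner 0 v = 0.
Proof. by rewrite -(scale0r 0) innerZl mul0r. Qed.

Lemma inner_suml (I : finType) (f : I -> 'rV[R]_d) v :
  inner (\sum_i f i) v = \sum_i inner (f i) v.
Proof.
by elim/big_rec2: _ => [|i a b _ <-]; rewrite ?inner0l ?innerDl.
Qed.

Lemma inner_ge0 u : 0 <= inner u u.
Proof. by apply: sumr_ge0 => i _; rewrite -expr2 sqr_ge0. Qed.

Lemma inner_eq0 u : (inner u u == 0) = (u == 0).
Proof.
apply/eqP/eqP => [h|->]; last by rewrite inner0l.
apply/rowP => i; rewrite mxE; apply/eqP; rewrite -sqrf_eq0 expr2; apply/eqP.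
by apply: (psumr_eq0P _ h) => // k _; rewrite -expr2 sqr_ge0.
Qed.

Lemma enorm_ge0 u : 0 <= enorm u.
Proof. exact: sqrtr_ge0. Qed.

Lemma sqr_enorm u : enorm u ^+ 2 = inner u u.
Proof. by rewrite sqr_sqrtr ?inner_ge0. Qed.

Definition innerE :=
  (innerDl, innerDr, innerNl, innerNr, innerZl, innerZr, inner0l).

Lemma inner_young u v : 2 * inner u v <= inner u u + inner v v.
Proof.
have := inner_ge0 (u - v); rewrite !innerE (innerC v u); lra.
Qed.

(** Each coordinate is at most the max norm. This transfers boundedness of compact sets, known for
    the max norm, to Euclidean distances. *)
Lemma inner_le_norm u : inner u u <= d%:R * `|u| ^+ 2.
Proof.
rewrite /inner.
apply: (@le_trans _ _ (\sum_(i < d) `|u| ^+ 2)); last first.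
  by rewrite sumr_const card_ord mulr_natl.
apply: ler_sum => i _; rewrite -expr2 -real_normK ?num_real // lerXn2r ?nnegrE //.
rewrite -[`|u|]/(mx_norm u) mx_normrE.
exact: (le_bigmax_cond _ (fun k => `|u k.1 k.2|) (erefl _ : xpredT (0, i))).
Qed.

End Inner.

(** * Uniform averages over a finite type *)

Section Mean.
Context {R : realType} {I : finType}.
Implicit Types f g : I -> R.

Definition mean f : R := #|I|%:R^-1 * \sum_i f i.

Lemma eq_mean f g : f =1 g -> mean f = mean g.
Proof. by move=> fg; congr (_ * _); apply: eq_bigr => i _; exact: fg. Qed.

Lemma meanD f g : mean (fun i => f i + g i) = mean f + mean g.
Proof. by rewrite /mean big_split mulrDr. Qed.

Lemma meanZ (a : R) f : mean (fun i => a * f i) = a * mean f.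
Proof. by rewrite /mean -mulr_sumr mulrCA. Qed.

Lemma meanN f : mean (fun i => - f i) = - mean f.
Proof. by rewrite /mean sumrN mulrN. Qed.

Lemma ler_mean f g : (forall i, f i <= g i) -> mean f <= mean g.
Proof. by move=> fg; rewrite ler_wpM2l ?invr_ge0 // ler_sum. Qed.

Lemma mean_sum (m : nat) (f : nat -> I -> R) :
  mean (fun i => \sum_(k < m) f k i) = \sum_(k < m) mean (f k).
Proof. by rewrite /mean exchange_big mulr_sumr. Qed.

Lemma mean_cst (a : R) : (0 < #|I|)%N -> mean (fun=> a) = a.
Proof.
move=> I0; rewrite /mean sumr_const -[a *+ _]mulr_natl mulrA mulVf ?mul1r//.
by rewrite pnatr_eq0 -lt0n.
Qed.

End Mean.

(** * The proximal operator of a proper convex function, and Jensen's inequality *)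

Section Prox.
Context {R : realType} {d : nat} (r : 'rV[R]_d -> \bar R) (gamma : R).
Hypotheses (r_proper : proper_reg r) (r_convex : econvex r) (gamma_gt0 : 0 < gamma).
Implicit Types u v y p : 'rV[R]_d.

(** Comparing [p] with a point where [r] is finite excludes [+oo]; properness excludes [-oo]. *)
Lemma prox_fin_num y p : prox gamma r y p -> r p \is a fin_num.
Proof.
move=> [_ /=]; have [rNy [v rv]] := r_proper.
move=> /(_ v I); have := rNy p; have := rNy v; move: rv.
by case: (r v) => [a| |] //; case: (r p).
Qed.

(* First order optimality along the segment from [p] to [u], whose parameter
   tends to 0. *)
Lemma prox_variational y p u : prox gamma r y p -> r u \is a fin_num ->
  inner (y - p) (u - p) <= gamma * (fine (r u) - fine (r p)).
Proof.
move=> pp ru; have rp := prox_fin_num _ _ pp; case: pp => _ /= pmin.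
have key t : 0 < t <= 1 ->
    0 <= gamma * (fine (r u) - fine (r p)) - inner (y - p) (u - p)
         + t / 2 * inner (u - p) (u - p).
  move=> /andP[t0 t1].
  have := pmin (t *: u + (1 - t) *: p)%R I.
  have /(r_convex u p) : 0 <= t <= 1 by rewrite ltW.
  move: (r_proper.1 (t *: u + (1 - t) *: p)%R).
  rewrite -(fineK ru) -(fineK rp).
  case: (r (_ + _)%R) => [c| |] //= _; rewrite -?EFinM -?EFinD ?lee_fin //.
  rewrite !sqr_enorm => h1 h2.
  have E : t *: u + (1 - t) *: p - y = (p - y) + t *: (u - p).
    by apply/rowP => i; rewrite !mxE; ring.
  rewrite E !innerE in h2.
  have {h1}h2 := le_trans h2 (lerD h1 (lexx _)).
  have {}h2 : 0 <= 2 * gamma * (t * (fine (r u) - fine (r p)))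
      + (2 * t * inner (p - y) (u - p) + t ^+ 2 * inner (u - p) (u - p)).
    have g0 : gamma != 0 by rewrite gt_eqF.
    have g2 : 0 < 2 * gamma by rewrite mulr_gt0.
    rewrite -(ler_pM2l g2) in h2.
    have e (a b : R) :
        2 * gamma * (a + b / (2 * gamma)) = 2 * gamma * a + b by field.
    rewrite !e in h2; move: h2; rewrite !innerE.
    rewrite (innerC y p) (innerC u p) (innerC u y); lra.
  have t2 : 0 < 2 * t by rewrite mulr_gt0.
  rewrite -(pmulr_rge0 _ t2).
  move: h2; rewrite !innerE; lra.
set a := inner _ _; set b := gamma * _; set c := inner (u - p) (u - p) in key.
have c0 : 0 <= c by exact: inner_ge0.
rewrite leNgt; apply/negP => ba.
(* If [a > b], this [t] satisfies [t * c <= a - b], so [key] would give [0 <= (b - a) / 2]. Adding 1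
   to [c] keeps the quotient meaningful when [c = 0]. *)
have := key (Num.min 1 ((a - b) / (c + 1))).
have q0 : 0 < (a - b) / (c + 1) by rewrite divr_gt0 //; lra.
have /[swap]/[apply] : 0 < Num.min 1 ((a - b) / (c + 1)) <= 1.
  by rewrite lt_min ltr01 q0 ge_min lexx.
have : Num.min 1 ((a - b) / (c + 1)) * c <= a - b.
  apply: (@le_trans _ _ ((a - b) / (c + 1) * c)).
    by rewrite ler_wpM2r // ge_min lexx orbT.
  rewrite mulrAC ler_pdivrMr; last lra.
  by rewrite ler_wpM2l //; lra.
rewrite -/a -/b; lra.
Qed.

(** Testing the variational inequality of each point with the other and adding, the values of [r]
    cancel and [|p - p'|^2 <= 0] remains. *)
Lemma prox_unique y p p' : prox gamma r y p -> prox gamma r y p' -> p = p'.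
Proof.
move=> pp pp'; have rp := prox_fin_num _ _ pp; have rp' := prox_fin_num _ _ pp'.
have h1 := prox_variational _ _ _ pp rp'.
have h2 := prox_variational _ _ _ pp' rp.
apply/eqP; rewrite -subr_eq0 -inner_eq0 eq_le inner_ge0 andbT.
move: h1 h2; rewrite !innerE (innerC p' p); lra.
Qed.

(** This is [prox_variational] at [x - gamma *: g], with [2 <x - p, u - p>] expanded by
    polarization. *)
Lemma prox_descent x g p u : prox gamma r (x - gamma *: g) p ->
  r u \is a fin_num ->
  2 * gamma * (inner g (p - u) + (fine (r p) - fine (r u))) <=
  inner (x - u) (x - u) - inner (p - u) (p - u) - inner (p - x) (p - x).
Proof.
move=> pp ru; have := prox_variational _ _ _ pp ru; rewrite !innerE.
rewrite (innerC p x) (innerC u x) (innerC u p); lra.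
Qed.

(** Jensen by induction: the average of [m.+2] points combines the last point, with weight
    [t = 1 / m.+2], and the average of the others, with weight [1 - t]. *)
Lemma econvex_average (y : nat -> 'rV[R]_d) (m : nat) :
  (forall k, r (y k) \is a fin_num) ->
  (r (m.+1%:R^-1 *: \sum_(k < m.+1) y k)%R <=
   (m.+1%:R^-1 * \sum_(k < m.+1) fine (r (y k)))%:E)%E.
Proof.
move=> ry; elim: m => [|m IH].
  by rewrite !big_ord1 invr1 scale1r mul1r fineK.
have m1 : m.+1%:R != 0 :> R by rewrite pnatr_eq0.
have m2 : m.+2%:R != 0 :> R by rewrite pnatr_eq0.
set t : R := m.+2%:R^-1.
have t01 : 0 <= t <= 1 by rewrite invr_ge0 ler0n invf_le1 ?ltr0n // ler1n.
have tE : (1 - t) * m.+1%:R^-1 = t.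
  move: m2; rewrite /t -(natr1 m.+1); move: (m.+1%:R) m1 => a a0 a1.
  by field; rewrite a0 a1.
rewrite 2![\sum_(_ < m.+2) _]big_ord_recr /=.
set s := (\sum_(i < m.+1) y i) in IH *; set q := \sum_(i < m.+1) _ in IH *.
have := r_convex (y m.+1) (m.+1%:R^-1 *: s)%R _ t01.
rewrite scalerA tE -scalerDr addrC => /le_trans; apply.
have -> : t * (q + fine (r (y m.+1))) =
    t * fine (r (y m.+1)) + (1 - t) * (m.+1%:R^-1 * q).
  by rewrite mulrA tE mulrDr addrC.
rewrite (EFinD (t * _)) (EFinM t) (EFinM (1 - t)).
have /andP[_ t1] := t01.
apply: leeD; first by rewrite fineK // lexx.
by apply: lee_wpmul2l => //; rewrite lee_fin subr_ge0.
Qed.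

End Prox.

(** * Functions of finitely many draws, and averages over histories *)

Section History.
Context {R : realType} {T : Type} {n K : nat} (j : nat -> T -> 'I_n).

Definition same_history (k : nat) (om om' : T) : Prop :=
  forall i, (i < k)%N -> j i om = j i om'.

(** Measurability with respect to the first [k] draws, expressed as functional dependence; this
    suffices because the draws take finitely many values. *)
Definition adapted (k : nat) {V : Type} (f : T -> V) : Prop :=
  forall om om', same_history k om om' -> f om = f om'.

Lemma same_historyW k k' om om' : (k <= k')%N -> same_history k' om om' ->
  same_history k om om'.
Proof. by move=> kk' h i ik; apply: h; exact: leq_trans kk'. Qed.

Variable rep : {ffun 'I_K -> 'I_n} -> T.
Hypothesis repE : forall s (i : 'I_K), j i (rep s) = s i.

(** The expectation of a function of the first [K] draws, read off at one outcome [rep s] per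
    history [s]. *)
Definition hmean (f : T -> R) : R := mean (fun s => f (rep s)).

(* Exchanging the [k]-th draw of the history with the averaging index is an
   involution. *)
Lemma hmean_draw (k : nat) (f : T -> 'I_n -> R) : (k < K)%N -> (0 < n)%N ->
  (forall i, adapted k (f^~ i)) ->
  hmean (fun om => f om (j k om)) = hmean (fun om => mean (f om)).
Proof.
move=> kK n0 fad; pose k' := Ordinal kK.
pose upd (s : {ffun 'I_K -> 'I_n}) i := [ffun q => if q == k' then i else s q].
(* [rep (upd s i)] may be an outcome unrelated to [rep s], but both have the same draws before [k],
   and [f] sees only those. *)
have fupd s i i' : f (rep (upd s i)) i' = f (rep s) i'.
  apply: fad => q qk; have qK := ltn_trans qk kK.
  rewrite (repE _ (Ordinal qK)) (repE _ (Ordinal qK)) ffunE -val_eqE /=.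
  by rewrite ltn_eqF.
pose sw (p : {ffun 'I_K -> 'I_n} * 'I_n) := (upd p.1 p.2, p.1 k').
have swK : involutive sw.
  move=> [s i]; rewrite /sw /= ffunE eqxx; congr pair.
  by apply/ffunP => q; rewrite !ffunE; case: eqP => // ->.
rewrite /hmean /mean -mulr_sumr card_ord; congr (_ * _).
under eq_bigr do rewrite (repE _ k').
rewrite pair_big /= (reindex_inj (inv_inj swK)) /=.
under [in RHS]eq_bigr do rewrite fupd.
rewrite -(pair_big xpredT xpredT (fun s i => f (rep s) (s k'))) /=.
rewrite [in RHS](eq_bigr (fun s => n%:R * f (rep s) (s k'))); last first.
  by move=> s _; rewrite sumr_const card_ord mulr_natl.
by rewrite -mulr_sumr mulrA mulVf ?mul1r // pnatr_eq0 -lt0n.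
Qed.

End History.

(** * The law of the draws: every history has the same probability *)

Section Law.
Context {disp : measure_display} {T : measurableType disp} {R : realType}.
Context (P : probability T R) {n K : nat} (j : nat -> T -> 'I_n).
Hypotheses (n_gt0 : (0 < n)%N) (j_iid : iid_uniform P j).
Implicit Type s : {ffun 'I_K -> 'I_n}.

Definition history_event s : set T := [set om | forall i : 'I_K, j i om = s i].

Lemma measurable_history_event s : measurable (history_event s).
Proof.
rewrite (_ : history_event s = \bigcap_(i in [set: 'I_K]) j i @^-1` [set s i]).
  apply: fin_bigcap_measurable => // i _; exact: (iid_measurable j_iid).
by apply/seteqP; split=> [om h i _|om h i]; [exact: h|exact: h i I].
Qed.

Lemma history_event_prob s : P (history_event s) = (n%:R^-1 ^+ K)%:E.
Proof.
(* For [k < K] this is the singleton of the value of [s] at [k]; for larger [k] it is vacuously the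
   full set. *)
pose A k : set 'I_n := [set a | forall i : 'I_K, i = k :> nat -> a = s i].
rewrite (_ : history_event s = [set om | forall k, (k < K)%N -> A k (j k om)]).
  rewrite (iid_independent j_iid).
  rewrite (eq_bigr (fun=> (n%:R^-1)%:E)) => [|i _].
    by rewrite prodEFin prodr_const card_ord.
  rewrite -(iid_uniform_law j_iid i (s i)); congr (P (_ @^-1` _)).
  apply/seteqP; split=> a /=; first exact.
  by move=> -> k /val_inj ->.
apply/seteqP; split=> om h; first by move=> k kK i /= <-; exact: h.
by move=> i; exact: h (ltn_ord i) i erefl.
Qed.

(** An empty history event would have probability 0, whereas its probability is [n ^- K], which is
    nonzero. *)
Lemma history_representative :
  exists rep : {ffun 'I_K -> 'I_n} -> T, forall s (i : 'I_K), j i (rep s) = s i.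
Proof.
suff /choice[rep repE] : forall s, exists om, forall i : 'I_K, j i om = s i.
  by exists rep.
move=> s.
apply/not_existsP => h.
have : P (history_event s) = 0%E.
  by rewrite (_ : history_event s = set0) ?measure0 // -subset0 => om /h.
rewrite history_event_prob => -[] /eqP.
by rewrite expf_eq0 invr_eq0 pnatr_eq0 (gtn_eqF n_gt0) andbF.
Qed.

Variable rep : {ffun 'I_K -> 'I_n} -> T.
Hypothesis repE : forall s (i : 'I_K), j i (rep s) = s i.

(** An adapted [f] is a finite combination of indicators of history events, hence integrable, and
    all these events have equal probability. *)
Lemma integral_adapted (f : T -> R) : adapted j K f ->
  (\int[P]_om (f om)%:E = (hmean rep f)%:E)%E.
Proof.
move=> fad.
have fE om : (f om)%:E =
    (\sum_s (f (rep s))%:E * (\1_(history_event s) om)%:E)%E.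
  pose s := [ffun i : 'I_K => j i om].
  rewrite (bigD1 s) //= big1 => [|s' s's].
    rewrite adde0 indicE mem_set ?mule1 => [|i]; last by rewrite ffunE.
    congr EFin; apply: fad => i iK.
    by rewrite (repE s (Ordinal iK)) ffunE.
  rewrite indicE memNset ?mule0 // => h; move/eqP: s's; apply.
  by apply/ffunP => i; rewrite -h ffunE.
under eq_integral do rewrite fE.
have int1 s : P.-integrable setT (fun om => (\1_(history_event s) om)%:E).
  by apply: integrable_indic; exact: measurable_history_event.
rewrite integral_sum //; last by move=> s; exact: integrableZl.
rewrite /hmean /mean mulr_sumr -sumEFin; apply: eq_bigr => s _.
rewrite integralZl // integral_indic //; last exact: measurable_history_event.
rewrite setIT.
rewrite [X in (_ * X)%E](_ : _ = (n%:R^-1 ^+ K)%:E); last exact: history_event_prob.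
rewrite -EFinM mulrC card_ffun !card_ord natrX exprVn.
by [].
Qed.

End Law.

(** * Mean and variance of a finite family of vectors *)

Section Variance.
Context {R : realType} {I : finType} {d : nat} (f : I -> 'rV[R]_d).
Hypothesis I_gt0 : (0 < #|I|)%N.

Definition mean_vec : 'rV[R]_d := #|I|%:R^-1 *: \sum_i f i.

Lemma mean_inner v : mean (fun i => inner (f i) v) = inner mean_vec v.
Proof. by rewrite /mean_vec innerZl inner_suml. Qed.

(** The second moment about [c] exceeds the variance by exactly [|m - c|^2]. *)
Lemma variance_le (c : 'rV[R]_d) :
  mean (fun i => inner (f i - mean_vec) (f i - mean_vec)) <=
  mean (fun i => inner (f i - c) (f i - c)).
Proof.
set m := mean_vec.
rewrite (@eq_mean _ _ _ (fun i => inner (f i - c) (f i - c) +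
    (- 2 * inner (f i) (m - c) + (inner m m - inner c c)))); last first.
  move=> i /=; move: m (f i) => m u.
  by rewrite !innerE (innerC m u) (innerC c u); ring.
rewrite meanD meanD meanZ mean_cst // mean_inner -/m.
have := inner_ge0 (m - c); move: m => m; rewrite !innerE (innerC c m); lra.
Qed.

End Variance.

(** * One SAGA step, averaged over the drawn index *)

Section OneStep.
Context {R : realType} {d n : nat} (Fi : 'I_n -> 'rV[R]_d -> 'rV[R]_d).
Context (xs y : 'rV[R]_d) (w : 'I_n -> 'rV[R]_d).
Hypothesis n_gt0 : (0 < n)%N.

Let card_gt0 : (0 < #|'I_n|)%N. Proof. by rewrite card_ord. Qed.

(** The subtracted memory terms average to the memory mean that the estimator adds back. *)
Lemma mean_vec_saga_estimator :
  mean_vec (saga_estimator Fi y w) = average_op Fi y.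
Proof.
rewrite /mean_vec /saga_estimator card_ord /average_op !big_split /= sumrN.
rewrite sumr_const card_ord -[(_ *: _) *+ n]scaler_nat scalerA.
by rewrite divff ?pnatr_eq0 -?lt0n // scale1r addrNK.
Qed.

(** The error is [p i] minus the centred [q i]. After [|a - b|^2 <= 2 |a|^2 + 2 |b|^2], the variance
    of [q] is at most its second moment, which is [sigma2]. *)
Lemma mean_saga_estimator_norm2 :
  mean (fun i => inner (saga_estimator Fi y w i - average_op Fi xs)
                       (saga_estimator Fi y w i - average_op Fi xs)) <=
  2 * (n%:R^-1 * \sum_i enorm (Fi i y - Fi i xs) ^+ 2) + 2 * sigma2 Fi w xs.
Proof.
pose p i := Fi i y - Fi i xs; pose q i := Fi i (w i) - Fi i xs.
have qE : mean_vec q = n%:R^-1 *: \sum_i Fi i (w i) - average_op Fi xs.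
  by rewrite /mean_vec /q card_ord /average_op big_split /= sumrN scalerBr.
have gE i : saga_estimator Fi y w i - average_op Fi xs =
    p i - (q i - mean_vec q).
  by rewrite qE /saga_estimator /p /q; apply/rowP => k; rewrite !mxE; ring.
apply: (@le_trans _ _ (mean (fun i => 2 * inner (p i) (p i) +
    2 * inner (q i - mean_vec q) (q i - mean_vec q)))).
  apply: ler_mean => i; rewrite gE.
  move: (p i) (q i - mean_vec q) => a b.
  have := inner_ge0 (a + b); rewrite !innerE (innerC b a); lra.
rewrite meanD !meanZ lerD //.
  rewrite /mean card_ord ler_pM2l ?ltr0n // ler_wpM2l ?invr_ge0 //.
  by apply: ler_sum => i _; rewrite sqr_enorm.
rewrite ler_pM2l ?ltr0n //.
have /le_trans -> // := variance_le q card_gt0 0.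
rewrite /mean card_ord /sigma2 ler_wpM2l ?invr_ge0 //.
by apply: ler_sum => i _; rewrite subr0 sqr_enorm.
Qed.

(** Drawing [a] changes only the [a]-th summand, so each summand is refreshed with probability
    [1 / n]. *)
Lemma mean_sigma2_update :
  mean (fun a => sigma2 Fi (fun i => if i == a then y else w i) xs) =
  sigma2 Fi w xs + n%:R^-1 *
    (n%:R^-1 * (\sum_i enorm (Fi i y - Fi i xs) ^+ 2) - sigma2 Fi w xs).
Proof.
rewrite (@eq_mean _ _ _ (fun a => sigma2 Fi w xs + n%:R^-1 *
   (enorm (Fi a y - Fi a xs) ^+ 2 + - enorm (Fi a (w a) - Fi a xs) ^+ 2))).
  by rewrite meanD mean_cst // meanZ meanD meanN /mean /sigma2 card_ord.
move=> a; rewrite /sigma2 -mulrDr (bigD1 a) //= eqxx (bigD1 a (P := xpredT)) //=.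
congr (_ * _); rewrite (eq_bigr (fun i => enorm (Fi i (w i) - Fi i xs) ^+ 2)).
  by ring.
by move=> i /negPf ->.
Qed.

Lemma sigma2_ge0 : 0 <= sigma2 Fi w xs.
Proof.
by rewrite mulr_ge0 ?invr_ge0 // sumr_ge0 // => i _; rewrite sqr_ge0.
Qed.

End OneStep.

(** * Inequalities along one trajectory of SAGA-SGDA *)

Section Saga.
Context {R : realType} {d n K : nat} {T : Type}.
Context (Fi : 'I_n -> 'rV[R]_d -> 'rV[R]_d) (F : 'rV[R]_d -> 'rV[R]_d).
Context (r : 'rV[R]_d -> \bar R) (gamma lhat : R) (xs x0 : 'rV[R]_d).
Context (j : nat -> T -> 'I_n) (x : nat -> T -> 'rV[R]_d).
Context (w : nat -> T -> 'I_n -> 'rV[R]_d).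
Hypotheses (n_gt0 : (0 < n)%N) (F_average : forall y, F y = average_op Fi y).
Hypotheses (r_proper : proper_reg r) (r_convex : econvex r).
Hypotheses (gamma_gt0 : 0 < gamma) (lhat_gt0 : 0 < lhat).
Hypothesis F_monotone : monotone_op F.
Hypothesis xs_sol : vi_solutions F r xs.
Hypothesis Fi_cocoercive : forall y,
  n%:R^-1 * \sum_(i < n) enorm (Fi i y - Fi i xs) ^+ 2
    <= lhat * inner (F y - F xs) (y - xs).
Hypothesis saga : forall om, saga_sgda Fi r gamma x0 (fun=> x0)
  (fun k => j k om) (fun k => x k om) (fun k => w k om).

Let estimator k om := saga_estimator Fi (x k om) (w k om) (j k om).
Let noise k om := estimator k om - F (x k om).
Let noise_sum m om := \sum_(k < m) noise k om.

(** If [r xs] were [+oo], testing the variational inequality at a point where [r] is finite would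
    give [-oo]. *)
Lemma vi_solution_fin_num : r xs \is a fin_num.
Proof.
have [rNy [v rv]] := r_proper.
have := xs_sol v; have := rNy xs; have := rNy v; move: rv.
by case: (r v) => [a| |] //; case: (r xs) => [b| |].
Qed.

Lemma vi_solution_fine u : r u \is a fin_num ->
  0 <= inner (F xs) (u - xs) + (fine (r u) - fine (r xs)).
Proof.
move=> ru; have := xs_sol u; have := vi_solution_fin_num.
case: (r xs) => // b _; case: (r u) ru => // a _.
by rewrite -EFinN -!EFinD lee_fin addrA.
Qed.

Lemma iterate_fin_num k om : r (x k.+1 om) \is a fin_num.
Proof. exact: (prox_fin_num _ _ r_proper _ _ (saga_xS (saga om) k)). Qed.

(** Iterate and memory are treated in one induction, since each step uses both; uniqueness of the
    proximal point determines the next iterate. *)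
Lemma saga_adapted k : adapted j k (x k) /\ adapted j k (w k).
Proof.
elim: k => [|k [IHx IHw]].
  split=> om om' _; first by rewrite (saga_x0 (saga om)) (saga_x0 (saga om')).
  by apply/funext => i; rewrite (saga_w0 (saga om)) (saga_w0 (saga om')).
have same om om' : same_history j k.+1 om om' ->
    [/\ x k om = x k om', w k om = w k om' & j k om = j k om'].
  move=> h; have hk := same_historyW _ _ _ _ _ (leqnSn k) h.
  by split; [exact: IHx|exact: IHw|exact: h].
split=> om om' /same[ex ew ej].
  have pp' := saga_xS (saga om') k; rewrite -ex -ew -ej in pp'.
  have pp := saga_xS (saga om) k.
  exact: (prox_unique _ _ r_proper r_convex gamma_gt0 _ _ _ pp pp').
by apply/funext => i; rewrite (saga_wS (saga om)) (saga_wS (saga om')) ex ew ej.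
Qed.

Lemma iterate_adapted k : adapted j k (x k).
Proof. by case: (saga_adapted k). Qed.

Lemma memory_adapted k : adapted j k (w k).
Proof. by case: (saga_adapted k). Qed.

Lemma noise_adapted k : adapted j k.+1 (noise k).
Proof.
move=> om om' h; have hk := same_historyW _ _ _ _ _ (leqnSn k) h.
rewrite /noise /estimator (iterate_adapted k _ _ hk) (memory_adapted k _ _ hk).
by rewrite (h k (ltnSn k)).
Qed.

Lemma noise_sum_adapted m : adapted j m (noise_sum m).
Proof.
move=> om om' h; apply: eq_bigr => k _; apply: noise_adapted.
exact: same_historyW _ _ _ _ _ (ltn_ord k) h.
Qed.

(** The variational inequality at the new iterate removes [r] and replaces [g] by [g - F xs].
    Young's inequality then absorbs [<g - F xs, p - y>] into [|p - y|^2], where [p] and [y] are the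
    new and old iterates. *)
Lemma iterate_descent k om :
  inner (x k.+1 om - xs) (x k.+1 om - xs) <=
  inner (x k om - xs) (x k om - xs)
  - 2 * gamma * inner (estimator k om - F xs) (x k om - xs)
  + gamma ^+ 2 * inner (estimator k om - F xs) (estimator k om - F xs).
Proof.
have := prox_descent _ _ r_proper r_convex gamma_gt0 _ _ _ _
  (saga_xS (saga om) k) vi_solution_fin_num.
have := mulr_ge0 (ltW gamma_gt0) (vi_solution_fine _ (iterate_fin_num k om)).
rewrite -/(estimator k om).
move: xs (F xs) (x k.+1 om) (x k om) (estimator k om) => z f p y g.
have := inner_young (- gamma *: (g - f)) (p - y); rewrite !innerE.
rewrite (innerC p y) (innerC p z) (innerC y z) (innerC f g); lra.
Qed.

(** Monotonicity replaces [F (x k om)] by [F u], leaving an increment of [<F u, x k om>] that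
    telescopes. The noise is paired with [x k om - u], split at [x0] so that [u] meets only a fixed
    vector. *)
Lemma gap_term_descent k om u : r u \is a fin_num ->
  2 * gamma * (inner (F u) (x k.+1 om - u)
               + (fine (r (x k.+1 om)) - fine (r u))) <=
  inner (x k om - u) (x k om - u) - inner (x k.+1 om - u) (x k.+1 om - u)
  + 2 * gamma * (inner (F u) (x k.+1 om) - inner (F u) (x k om))
  - 2 * gamma * inner (noise k om) (x k om - x0)
  - 2 * gamma * inner (noise k om) (x0 - u)
  + gamma ^+ 2 * inner (estimator k om) (estimator k om).
Proof.
move=> ru; have := prox_descent _ _ r_proper r_convex gamma_gt0 _ _ _ _
  (saga_xS (saga om) k) ru.
have := mulr_ge0 (ltW gamma_gt0) (F_monotone (x k om) u).
rewrite /noise -/(estimator k om).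
move: (fine _) (fine _) => a b.
move: (x k.+1 om) (x k om) (estimator k om) (F u) (F (x k om)) => p y g f f'.
have := inner_young (- gamma *: g) (p - y); rewrite !innerE.
rewrite (innerC p y) (innerC p u) (innerC y u); lra.
Qed.

Lemma gap_sum_descent m om u : r u \is a fin_num ->
  2 * gamma * \sum_(k < m) (inner (F u) (x k.+1 om - u)
               + (fine (r (x k.+1 om)) - fine (r u))) <=
  inner (x0 - u) (x0 - u) - inner (x m om - u) (x m om - u)
  + 2 * gamma * (inner (F u) (x m om) - inner (F u) x0)
  - 2 * gamma * (\sum_(k < m) inner (noise k om) (x k om - x0))
  - 2 * gamma * inner (noise_sum m om) (x0 - u)
  + gamma ^+ 2 * \sum_(k < m) inner (estimator k om) (estimator k om).
Proof.
move=> ru; elim: m => [|m IH].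
  by rewrite /noise_sum !big_ord0 (saga_x0 (saga om)) inner0l; lra.
move: IH (gap_term_descent m om u ru).
rewrite /noise_sum ![\sum_(_ < m.+1) _]big_ord_recr /= (innerDl (\sum_(_ < m) _)).
lra.
Qed.

(** * Recursions in expectation, summed over the iterations *)

Context (rep : {ffun 'I_K -> 'I_n} -> T).
Hypothesis repE : forall s (i : 'I_K), j i (rep s) = s i.
Let E f := hmean (R:=R) rep f.

Let hist_gt0 : (0 < #|{ffun 'I_K -> 'I_n}|)%N.
Proof. by rewrite card_ffun !card_ord expn_gt0 n_gt0. Qed.

Let dist2 k := E (fun om => inner (x k om - xs) (x k om - xs)).
Let corr k := E (fun om => inner (F (x k om) - F xs) (x k om - xs)).
Let memory2 k := E (fun om => sigma2 Fi (w k om) xs).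
Let estim2 k :=
  E (fun om => inner (estimator k om - F xs) (estimator k om - F xs)).

Lemma estim2_le k : (k < K)%N -> estim2 k <= 2 * lhat * corr k + 2 * memory2 k.
Proof.
move=> kK; pose f om i := inner
  (saga_estimator Fi (x k om) (w k om) i - average_op Fi xs)
  (saga_estimator Fi (x k om) (w k om) i - average_op Fi xs).
have -> : estim2 k = E (fun om => f om (j k om)).
  by apply: eq_mean => s; rewrite /f -F_average.
rewrite /E (hmean_draw _ _ repE) //; last first.
  move=> i om om' h.
  by rewrite /f (iterate_adapted k _ _ h) (memory_adapted k _ _ h).
rewrite /corr /memory2 /E /hmean -!meanZ -meanD; apply: ler_mean => s.
apply: le_trans (mean_saga_estimator_norm2 _ _ _ _ n_gt0) _.
by have := Fi_cocoercive (x k (rep s)); lra.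
Qed.

(** Since [v] depends only on earlier draws, it is fixed while draw [k] is averaged, and the
    estimator then averages to [F (x k om)]. *)
Lemma noise_unbiased k (v : T -> 'rV[R]_d) : (k < K)%N -> adapted j k v ->
  E (fun om => inner (noise k om) (v om)) = 0.
Proof.
move=> kK vad; pose f om i := inner
  (saga_estimator Fi (x k om) (w k om) i - F (x k om)) (v om).
rewrite -[LHS]/(E (fun om => f om (j k om))) /E (hmean_draw _ _ repE) //; last first.
  move=> i om om' h; rewrite /f (iterate_adapted k _ _ h).
  by rewrite (memory_adapted k _ _ h) (vad _ _ h).
rewrite /hmean -(mean_cst 0 hist_gt0); apply: eq_mean => s.
rewrite /f (@eq_mean _ _ _ (fun i =>
    inner (saga_estimator Fi (x k (rep s)) (w k (rep s)) i) (v (rep s))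
    + - inner (F (x k (rep s))) (v (rep s)))).
  rewrite meanD mean_cst ?card_ord // mean_inner mean_vec_saga_estimator //.
  by rewrite -F_average subrr.
by move=> i; rewrite innerDl innerNl.
Qed.

Lemma corr_estimator k : (k < K)%N ->
  E (fun om => inner (estimator k om - F xs) (x k om - xs)) = corr k.
Proof.
move=> kK; have := noise_unbiased k (fun om => x k om - xs) kK.
rewrite /corr /E /hmean => h; rewrite -[RHS]addr0 -[in RHS]h -?meanD.
  apply: eq_mean => s; rewrite -innerDl /noise; congr inner.
  by apply/rowP => i; rewrite !mxE; ring.
by move=> om om' h'; rewrite (iterate_adapted k _ _ h').
Qed.

(** [F (x k om)] is the conditional mean of the estimator, so the variance is at most the second
    moment about [F xs]. *)
Lemma noise_norm2 k : (k < K)%N ->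
  E (fun om => inner (noise k om) (noise k om)) <= estim2 k.
Proof.
move=> kK; pose g om i := saga_estimator Fi (x k om) (w k om) i.
have draw c : adapted j k c ->
    E (fun om => inner (g om (j k om) - c om) (g om (j k om) - c om)) =
    E (fun om => mean (fun i => inner (g om i - c om) (g om i - c om))).
  move=> cad; apply: (hmean_draw _ _ repE _
    (fun om i => inner (g om i - c om) (g om i - c om)) kK n_gt0) => i om om' h.
  rewrite /g (iterate_adapted k _ _ h) (memory_adapted k _ _ h).
  by rewrite (cad _ _ h).
have -> : estim2 k =
    E (fun om => mean (fun i => inner (g om i - F xs) (g om i - F xs))).
  exact: (draw (fun=> F xs)).
rewrite [leLHS](draw (fun om => F (x k om))); last first.
  by move=> om om' /(iterate_adapted k) ->.
apply: ler_mean => s; rewrite F_average.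
rewrite -(mean_vec_saga_estimator Fi _ (w k (rep s)) n_gt0).
by apply: (variance_le (g (rep s))); rewrite card_ord.
Qed.

Lemma memory2S k : (k < K)%N ->
  memory2 k.+1 <= memory2 k + n%:R^-1 * (lhat * corr k - memory2 k).
Proof.
move=> kK; pose f om a :=
  sigma2 Fi (fun i => if i == a then x k om else w k om i) xs.
have -> : memory2 k.+1 = E (fun om => f om (j k om)).
  apply: eq_mean => s; congr sigma2; apply/funext => i.
  exact: saga_wS (saga (rep s)) k i.
rewrite /E (hmean_draw _ _ repE) //; last first.
  move=> i om om' h.
  by rewrite /f (iterate_adapted k _ _ h) (memory_adapted k _ _ h).
rewrite /corr /memory2 /E /hmean -meanN -!meanZ -meanD -!meanZ -meanD.
apply: ler_mean => s; rewrite mean_sigma2_update // lerD2l.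
by rewrite ler_wpM2l ?invr_ge0 // lerD2r Fi_cocoercive.
Qed.

Lemma dist2S k : (k < K)%N ->
  dist2 k.+1 <= dist2 k - 2 * gamma * corr k + gamma ^+ 2 * estim2 k.
Proof.
move=> kK; rewrite -corr_estimator //.
rewrite /dist2 /estim2 /E /hmean -!meanZ -meanN -!meanD.
by apply: ler_mean => s; exact: iterate_descent.
Qed.

(** Increments are orthogonal: [noise_sum m] uses only the first [m] draws, so its cross term with
    [noise m] has mean zero. *)
Lemma noise_sum_norm2 m : (m <= K)%N ->
  E (fun om => inner (noise_sum m om) (noise_sum m om)) <=
  \sum_(k < m) estim2 k.
Proof.
elim: m => [|m IH] mK.
  rewrite big_ord0 /E /hmean (@eq_mean _ _ _ (fun=> 0)) ?mean_cst // => s.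
  by rewrite /noise_sum big_ord0 inner0l.
rewrite big_ord_recr /=.
have -> : E (fun om => inner (noise_sum m.+1 om) (noise_sum m.+1 om)) =
    E (fun om => inner (noise_sum m om) (noise_sum m om)) +
    (2 * E (fun om => inner (noise m om) (noise_sum m om)) +
    E (fun om => inner (noise m om) (noise m om))).
  rewrite /E /hmean -meanZ -!meanD; apply: eq_mean => s.
  rewrite (_ : noise_sum m.+1 (rep s) = noise_sum m (rep s) + noise m (rep s)).
    move: (noise_sum m (rep s)) (noise m (rep s)) => a b.
    by rewrite !innerE (innerC a b); ring.
  by rewrite /noise_sum big_ord_recr.
rewrite noise_unbiased // ?mulr0 ?add0r; last exact: noise_sum_adapted.
by rewrite lerD ?IH 1?ltnW // noise_norm2.
Qed.

Lemma memory2_ge0 k : 0 <= memory2 k.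
Proof.
rewrite /memory2 /E /hmean -(mean_cst 0 hist_gt0); apply: ler_mean => s.
exact: sigma2_ge0.
Qed.

Lemma dist2_ge0 k : 0 <= dist2 k.
Proof.
rewrite /dist2 /E /hmean -(mean_cst 0 hist_gt0); apply: ler_mean => s.
exact: inner_ge0.
Qed.

(** Multiplying [memory2S] by [n] makes [n * memory2] telescope and releases one [memory2 k] per
    step. *)
Lemma sum_memory2_le m : (m <= K)%N ->
  \sum_(k < m) memory2 k + n%:R * memory2 m <=
  n%:R * sigma2 Fi (fun=> x0) xs + lhat * \sum_(k < m) corr k.
Proof.
elim: m => [|m IH] mK.
  rewrite !big_ord0 mulr0 addr0 add0r ler_wpM2l //.
  rewrite /memory2 /E /hmean -[leRHS](mean_cst _ hist_gt0).
  apply: ler_mean => s; rewrite (_ : w 0%N (rep s) = fun=> x0) //.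
  by apply/funext => i; rewrite (saga_w0 (saga _)).
have := IH (ltnW mK).
have n0 : 0 < n%:R :> R by rewrite ltr0n.
have : n%:R * memory2 m.+1 <= n%:R * memory2 m + (lhat * corr m - memory2 m).
  have := memory2S m mK; rewrite -(ler_pM2l n0) => /le_trans; apply.
  by rewrite mulrDr mulVKf // gt_eqF.
rewrite ![\sum_(_ < m.+1) _]big_ord_recr /=; lra.
Qed.

Lemma sum_dist2_le m : (m <= K)%N ->
  dist2 m + 2 * gamma * \sum_(k < m) corr k <=
  inner (x0 - xs) (x0 - xs) + gamma ^+ 2 * \sum_(k < m) estim2 k.
Proof.
elim: m => [|m IH] mK.
  rewrite !big_ord0 !mulr0 !addr0.
  rewrite /dist2 /E /hmean -[leRHS](mean_cst _ hist_gt0).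
  by apply: ler_mean => s; rewrite (saga_x0 (saga _)).
have := IH (ltnW mK); have := dist2S m mK.
rewrite ![\sum_(_ < m.+1) _]big_ord_recr /=; lra.
Qed.

Lemma sum_estim2_le :
  \sum_(k < K) estim2 k <= 4 * lhat * \sum_(k < K) corr k
    + 2 * n%:R * sigma2 Fi (fun=> x0) xs.
Proof.
have h : \sum_(k < K) estim2 k <=
    2 * lhat * (\sum_(k < K) corr k) + 2 * \sum_(k < K) memory2 k.
  rewrite !mulr_sumr -big_split /=.
  by apply: ler_sum => k _; exact: estim2_le.
have := sum_memory2_le K (leqnn K).
have := mulr_ge0 (ler0n R n) (memory2_ge0 K); lra.
Qed.

(** As [6 * gamma * lhat <= 1], the term [4 * gamma ^+ 2 * lhat] from [sum_estim2_le] is at most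
    [2 / 3 * gamma], leaving [2 - 2 / 3 = 4 / 3]. *)
Lemma sum_corr_le : gamma * (6 * lhat) <= 1 ->
  4 / 3 * gamma * (\sum_(k < K) corr k) <=
  inner (x0 - xs) (x0 - xs) + 2 * n%:R * gamma ^+ 2 * sigma2 Fi (fun=> x0) xs.
Proof.
move=> gl; have := sum_dist2_le K (leqnn K); have := dist2_ge0 K.
have g2 : 0 <= gamma ^+ 2 by rewrite sqr_ge0.
have := ler_wpM2l g2 sum_estim2_le.
have c0 : 0 <= \sum_(k < K) corr k.
  apply: sumr_ge0 => k _; rewrite /corr /E /hmean -(mean_cst 0 hist_gt0).
  by apply: ler_mean => s; exact: F_monotone.
have gc : 0 <= gamma * \sum_(k < K) corr k by rewrite mulr_ge0 // ltW.
have := ler_wpM2r gc gl.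
set c := \sum_(_ < K) _; lra.
Qed.

(** A majorant free of [u]: all dependence on [u] is hidden in the constant [B]. Of the three copies
    of [|x0 - u|^2] in [B], one comes from telescoping and two from Young's inequality, against the
    noise sum and against [F u]. *)
Definition gap_bound (B : R) om : R :=
  B + gamma ^+ 2 * inner (noise_sum K om) (noise_sum K om)
  - 2 * gamma * (\sum_(k < K) inner (noise k om) (x k om - x0))
  + gamma ^+ 2 * (2 * \sum_(k < K) inner (estimator k om - F xs)
                                        (estimator k om - F xs)
                  + 2 * K%:R * inner (F xs) (F xs)).

(* The terms in [x K om] are absorbed by the telescoped [- |x K om - u|^2]. *)
Lemma gap_sum_le (om : T) (u : 'rV[R]_d) (B : R) : r u \is a fin_num ->
  3 * inner (x0 - u) (x0 - u) + 2 * gamma ^+ 2 * inner (F u) (F u) <= B ->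
  2 * gamma * \sum_(k < K) (inner (F u) (x k.+1 om - u)
               + (fine (r (x k.+1 om)) - fine (r u))) <= gap_bound B om.
Proof.
move=> ru hB; apply: (le_trans (gap_sum_descent K om u ru)).
have h : \sum_(k < K) inner (estimator k om) (estimator k om) <=
    2 * \sum_(k < K) inner (estimator k om - F xs) (estimator k om - F xs)
                  + 2 * K%:R * inner (F xs) (F xs).
  have -> : 2 * K%:R * inner (F xs) (F xs) =
      \sum_(k < K) 2 * inner (F xs) (F xs).
    by rewrite sumr_const card_ord -mulr_natr; ring.
  rewrite mulr_sumr -big_split /=; apply: ler_sum => k _.
  move: (estimator k om) (F xs) => g f.
  (* This square is the slack in [|g|^2 <= 2 |g - f|^2 + 2 |f|^2]. *)
  have := inner_ge0 (g - 2 *: f); rewrite !innerE (innerC f g); lra.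
have := ler_wpM2l (sqr_ge0 gamma) h.
rewrite /gap_bound; move: hB; move: (noise_sum K om) (x K om) (F u) => M y f.
have := inner_young (- gamma *: M) (x0 - u).
have := inner_young (gamma *: f) (y - u).
have := inner_young (gamma *: f) (u - x0).
rewrite !innerE (innerC u x0) (innerC y u); lra.
Qed.

(** In total [3 * gamma ^+ 2] times the sum of [estim2] appears; its correlation part
    [12 * gamma ^+ 2 * lhat] is [9 * gamma * lhat] times the left side of [sum_corr_le], whence 9
    and 18. *)
Lemma mean_gap_bound (B : R) : gamma * (6 * lhat) <= 1 ->
  E (gap_bound B) <= B + 9 * gamma * lhat * inner (x0 - xs) (x0 - xs)
    + (6 + 18 * gamma * lhat) * n%:R * gamma ^+ 2 * sigma2 Fi (fun=> x0) xs
    + 2 * gamma ^+ 2 * K%:R * inner (F xs) (F xs).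
Proof.
move=> gl.
have -> : E (gap_bound B) =
    B + gamma ^+ 2 * E (fun om => inner (noise_sum K om) (noise_sum K om))
    - 2 * gamma * (\sum_(k < K) E (fun om => inner (noise k om) (x k om - x0)))
    + gamma ^+ 2 * (2 * \sum_(k < K) estim2 k + 2 * K%:R * inner (F xs) (F xs)).
  rewrite /E /hmean /gap_bound !meanD meanN !meanZ meanD meanZ !mean_cst //.
  by rewrite (mean_sum _ (fun k s => inner (noise k (rep s)) (x k (rep s) - x0)))
     (mean_sum _ (fun k s => inner (estimator k (rep s) - F xs)
                                   (estimator k (rep s) - F xs))).
rewrite big1 => [|k _]; last first.
  apply: noise_unbiased => // om om' h.
  by rewrite (iterate_adapted k _ _ h).
have g2 : 0 <= gamma ^+ 2 by rewrite sqr_ge0.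
have := ler_wpM2l g2 (noise_sum_norm2 K (leqnn K)).
have := ler_wpM2l g2 sum_estim2_le.
have gl0 : 0 <= gamma * lhat by rewrite ltW // mulr_gt0.
have := ler_wpM2l gl0 (sum_corr_le gl).
set c := \sum_(_ < K) corr _; lra.
Qed.

End Saga.

(** * Euclidean suprema over a compact set *)

Section Compact.
Context {R : realType} {d : nat} (C : set 'rV[R]_d).
Hypothesis C_compact : compact C.

Lemma compact_norm_bound : exists M : R, forall u, C u -> `|u| <= M.
Proof.
have [M [_ hM]] := compact_bounded C_compact.
by exists (M + 1) => u Cu; apply: (hM (M + 1)) => //; rewrite ltrDl.
Qed.

Lemma compact_enorm_le_sup (y u : 'rV[R]_d) : C u ->
  enorm (y - u) ^+ 2 <= sup [set enorm (y - v) ^+ 2 | v in C].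
Proof.
move=> Cu; apply: ub_le_sup; last by exists u.
have [M hM] := compact_norm_bound.
exists (d%:R * (`|y| + M) ^+ 2) => _ [v Cv <-]; rewrite sqr_enorm.
apply: (le_trans (inner_le_norm _)); rewrite ler_wpM2l //.
rewrite lerXn2r ?nnegrE ?addr_ge0 //; first exact: le_trans (hM v Cv).
by apply: (le_trans (ler_normB _ _)); rewrite lerD2l hM.
Qed.

Lemma compact_enorm_le_diameter (u v : 'rV[R]_d) : C u -> C v ->
  enorm (u - v) <= diameter C.
Proof.
move=> Cu Cv; apply: ub_le_sup; last by exists u => //; exists v.
have [M hM] := compact_norm_bound.
exists (Num.sqrt (d%:R * (M + M) ^+ 2)) => _ [a Ca [b Cb <-]].
rewrite /enorm ler_wsqrtr //.
apply: (le_trans (inner_le_norm _)); rewrite ler_wpM2l //.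
have M0 : 0 <= M by exact: le_trans (hM a Ca).
rewrite lerXn2r ?nnegrE ?addr_ge0 //.
by apply: (le_trans (ler_normB _ _)); rewrite lerD ?hM.
Qed.

End Compact.

(** * Gap values at the averaged iterate, and their expectation *)

Lemma gap_value_le {R : realType} {d m : nat} (r : 'rV[R]_d -> \bar R)
    (f u : 'rV[R]_d) (y : nat -> 'rV[R]_d) (b : R) :
  proper_reg r -> econvex r -> (forall k, r (y k) \is a fin_num) ->
  (r u \is a fin_num -> \sum_(k < m.+1) (inner f (y k - u)
     + (fine (r (y k)) - fine (r u))) <= m.+1%:R * b) ->
  let z := (m.+1%:R^-1 *: \sum_(k < m.+1) y k)%R in
  r z \is a fin_num /\ ((inner f (z - u))%:E + r z - r u <= b%:E)%E.
Proof.
move=> [rNy _] rconv ry hb z.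
have := econvex_average _ rconv y m ry; rewrite -/z => hz.
have rz : r z \is a fin_num.
  by move: hz (rNy z); case: (r z).
split=> //; move: hz; rewrite -(fineK rz) lee_fin => hz.
(* Where [r u = +oo], the left side is [-oo] and the bound is trivial. Otherwise the inner product
   averages exactly and [r] by Jensen. *)
move: hb (rNy u); case: (r u) => [a /(_ isT)| |] //= hb _; last by rewrite leNye.
  rewrite lee_fin.
  have m0 : 0 < m.+1%:R :> R by rewrite ltr0n.
  rewrite -(ler_pM2l m0); apply: le_trans hb.
  rewrite big_split /= big_split /= sumrN !sumr_const card_ord.
  have -> : \sum_(i < m.+1) inner f (y i - u) = m.+1%:R * inner f (z - u).
    rewrite -innerZr scalerBr /z scalerA divff ?gt_eqF // scale1r.
    rewrite [RHS]innerC.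
    under eq_bigr do rewrite innerC.
    by rewrite -inner_suml sumrB sumr_const card_ord scaler_nat.
  move: hz; rewrite -(ler_pM2l m0) mulrA divff ?gt_eqF // mul1r.
  rewrite -[a *+ _]mulr_natl; lra.
Qed.

(** Once the integral of [f] is a finite average, the bound by [Y] is compared history by
    history. *)
Lemma integral_le_hmean {disp : measure_display} {T : measurableType disp}
    {R : realType} (P : probability T R) {n K : nat} (j : nat -> T -> 'I_n)
    (rep : {ffun 'I_K -> 'I_n} -> T) (f : T -> \bar R) (Y : T -> R) :
  (0 < n)%N -> iid_uniform P j ->
  (forall s (i : 'I_K), j i (rep s) = s i) ->
  adapted j K f -> (forall om, f om \is a fin_num) ->
  (forall om, f om <= (Y om)%:E)%E ->
  (\int[P]_om f om <= (hmean rep Y)%:E)%E.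
Proof.
move=> n0 iid repE fad ffin fY.
under eq_integral do rewrite -(fineK (ffin _)).
rewrite (integral_adapted P j iid rep repE (fun om => fine (f om))).
  rewrite lee_fin; apply: ler_mean => s.
  by have := fY (rep s); rewrite -{1}(fineK (ffin _)) lee_fin.
by move=> om om' /fad ->.
Qed.

Theorem theoremF15 (R : realType) (d n : nat)
  (Fi : 'I_n -> 'rV[R]_d -> 'rV[R]_d) (F : 'rV[R]_d -> 'rV[R]_d)
  (r : 'rV[R]_d -> \bar R) (C : set 'rV[R]_d)
  (l lhat gamma : R) (xs x0 xs0 : 'rV[R]_d)
  (disp : measure_display) (T : measurableType disp) (P : probability T R)
  (j : nat -> T -> 'I_n) (x : nat -> T -> 'rV[R]_d)
  (w : nat -> T -> 'I_n -> 'rV[R]_d)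
  (hn : (0 < n)%N)
  (hF : forall y, F y = average_op Fi y)
  (hr_proper : proper_reg r)
  (hr_lsc : lower_semicontinuous r)
  (hr_convex : econvex r)
  (hF_monotone : monotone_op F)
  (hF_star_cocoercive : star_cocoercive l (vi_solutions F r) F)
  (hC_compact : compact C)
  (hC_convex : @convex_set R 'rV[R]_d C)
  (hC_sol : vi_solutions F r `<=` C)
  (hlhat : 0 < lhat)
  (hFi : forall y ys, proj_on (vi_solutions F r) y ys ->
    n%:R^-1 * \sum_(i < n) enorm (Fi i y - Fi i ys) ^+ 2
      <= lhat * inner (F y - F ys) (y - ys))
  (hsingleton : vi_solutions F r = [set xs])
  (hgamma : 0 < gamma <= 1 / (6 * lhat))
  (hxs0 : proj_on (vi_solutions F r) x0 xs0)
  (hj : iid_uniform P j)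
  (hsaga : forall om, saga_sgda Fi r gamma x0 (fun=> x0)
    (fun k => j k om) (fun k => x k om) (fun k => w k om))
  (K : nat) (hK : (1 <= K)%N) :
  (\int[P]_om gap F r C (K%:R^-1 *: \sum_(1 <= k < K.+1) x k om)%R
   <= (3 * sup [set enorm (x0 - u) ^+ 2 | u in C] / (2 * gamma * K%:R)
       + 8 * gamma * l ^+ 2 * diameter C ^+ 2 / K%:R
       + (12 * lhat + l) * enorm (x0 - xs0) ^+ 2 / K%:R
       + (4 + (12 * lhat + l) * gamma)
         * (2 * n%:R * gamma * sigma2 Fi (fun=> x0) xs / K%:R)
       + 9 * gamma * sup [set enorm (F y) ^+ 2 | y in vi_solutions F r])%:E)%E.
Proof.
have /andP[gamma_gt0 gamma_le] := hgamma.
have gl : gamma * (6 * lhat) <= 1.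
  by rewrite -ler_pdivlMr // mulr_gt0.
have xs_sol : vi_solutions F r xs by rewrite hsingleton.
have Cxs : C xs by exact: hC_sol.
(* Every point projects onto the single solution, so both cocoercivity conditions hold with [xs]
   everywhere. *)
have proj_xs y : proj_on (vi_solutions F r) y xs.
  by split=> // z; rewrite hsingleton /= => ->.
have cocoercive y : n%:R^-1 * \sum_(i < n) enorm (Fi i y - Fi i xs) ^+ 2
    <= lhat * inner (F y - F xs) (y - xs) by exact: hFi.
have [l_gt0 star] := hF_star_cocoercive.
(* Young's inequality gives [2 l <f, v> <= |f|^2 + l^2 |v|^2], and star-cocoercivity bounds [|f|^2]
   by [l <f, v>]. *)
have F_lipschitz u : inner (F u - F xs) (F u - F xs) <=
    l ^+ 2 * inner (u - xs) (u - xs).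
  have := star u xs (proj_xs u); rewrite sqr_enorm.
  move: (F u - F xs) (u - xs) => f v.
  have := inner_young f (l *: v); rewrite innerZr innerZl innerZr; lra.
have -> : xs0 = xs by case: hxs0; rewrite hsingleton.
rewrite hsingleton image_set1 sup1 !sqr_enorm.
set B0 := sup _; set Om := diameter C.
(* The factor 4 is the 2 of [gap_sum_le] times that of
   [|F u|^2 <= 2 |F u - F xs|^2 + 2 |F xs|^2]. *)
pose B := 3 * B0 + 4 * gamma ^+ 2 * (l ^+ 2 * Om ^+ 2 + inner (F xs) (F xs)).
have hB u : C u ->
    3 * inner (x0 - u) (x0 - u) + 2 * gamma ^+ 2 * inner (F u) (F u) <= B.
  move=> Cu; have := compact_enorm_le_sup C hC_compact x0 u Cu.
  rewrite sqr_enorm -/B0 => h1.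
  have h2 : inner (u - xs) (u - xs) <= Om ^+ 2.
    rewrite -sqr_enorm lerXn2r ?nnegrE ?enorm_ge0 //.
      apply: le_trans (enorm_ge0 _) _.
      exact: (compact_enorm_le_diameter C hC_compact _ _ Cu Cu).
    exact: compact_enorm_le_diameter.
  have h3 := ler_wpM2l (sqr_ge0 l) h2.
  have h4 : inner (F u) (F u) <= 2 * (l ^+ 2 * Om ^+ 2) + 2 * inner (F xs) (F xs).
    have := le_trans (F_lipschitz u) h3; move: (F u) (F xs) => f f' h.
    have := inner_ge0 (f - 2 *: f').
    move: h; rewrite !innerE (innerC f' f); lra.
  have := ler_wpM2l (sqr_ge0 gamma) h4; rewrite /B; lra.
have [rep repE] := history_representative P (K := K) j hn hj.
pose Y := gap_bound (K := K) Fi F gamma xs x0 j x w B.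
have rx k om : r (x k.+1 om) \is a fin_num.
  exact: (iterate_fin_num Fi r gamma x0 j x w hr_proper hsaga).
have K_gt0 : 0 < K%:R :> R by rewrite ltr0n.
have gK : 0 < 2 * gamma * K%:R by rewrite !mulr_gt0.
(* Shifting the index gives the average of iterates 1 to [K], each of which is a proximal point with
   finite [r]. *)
pose z om := K%:R^-1 *: \sum_(k < K) x k.+1 om.
have zE om : K%:R^-1 *: \sum_(1 <= k < K.+1) x k om = z om.
  by rewrite big_add1 big_mkord.
have value om u : C u -> r (z om) \is a fin_num /\
    ((inner (F u) (z om - u))%:E + r (z om) - r u <=
     (Y om / (2 * gamma * K%:R))%:E)%E.
  move=> Cu.
  have main : r u \is a fin_num ->
      \sum_(k < K) (inner (F u) (x k.+1 om - u)
        + (fine (r (x k.+1 om)) - fine (r u))) <=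
      K%:R * (Y om / (2 * gamma * K%:R)).
    move=> ru; have g2 : 0 < 2 * gamma by rewrite mulr_gt0.
    rewrite -(ler_pM2l g2).
    have -> : 2 * gamma * (K%:R * (Y om / (2 * gamma * K%:R))) = Y om.
      by rewrite mulrA mulrC mulfVK // gt_eqF.
    exact: (gap_sum_le Fi F r gamma xs x0 j x w hr_proper hr_convex
      gamma_gt0 hF_monotone hsaga om u B ru (hB u Cu)).
  rewrite /z; case: (K) hK main => // m _ main.
  exact: (gap_value_le r (F u) u (fun k => x k.+1 om) _ hr_proper hr_convex
    (fun k => rx k om) main).
have gap_le om : (gap F r C (z om) <= (Y om / (2 * gamma * K%:R))%:E)%E.
  by apply: ge_ereal_sup => _ [u Cu <-]; case: (value om u Cu).
(* The majorant excludes [+oo], and the member [u = xs] of [C] supplies a finite lower bound. *)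
have gap_fin om : gap F r C (z om) \is a fin_num.
  have [rz _] := value om xs Cxs.
  have rxs := vi_solution_fin_num F r xs hr_proper xs_sol.
  rewrite fin_numE; apply/andP; split; last first.
    by apply: contraTneq (gap_le om) => ->; rewrite leye_eq.
  have : ((inner (F xs) (z om - xs))%:E + r (z om) - r xs <= gap F r C (z om))%E.
    by apply: ereal_sup_ubound; exists xs.
  rewrite -(fineK rz) -(fineK rxs).
  by apply: contraTneq => ->; rewrite leeNy_eq.
under eq_integral do rewrite zE.
have gap_adapted : adapted j K (fun om => gap F r C (z om)).
  move=> om om' h; congr gap; congr (_ *: _); apply: eq_bigr => k _.
  apply: (iterate_adapted Fi r gamma x0 j x w hr_proper hr_convex gamma_gt0 hsaga).
  exact: same_historyW h.
apply: le_trans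
  (integral_le_hmean P j rep _ _ hn hj repE gap_adapted gap_fin gap_le) _.
rewrite lee_fin.
have -> : hmean rep (fun om => Y om / (2 * gamma * K%:R)) =
    hmean rep Y / (2 * gamma * K%:R).
  by rewrite [RHS]mulrC /hmean -meanZ; apply: eq_mean => s; rewrite mulrC.
rewrite ler_pdivrMr //.
apply: le_trans (mean_gap_bound Fi F r gamma lhat xs x0 j x w hn hF hr_proper
  hr_convex gamma_gt0 hlhat hF_monotone xs_sol cocoercive hsaga rep repE B gl) _.
have S0 := sigma2_ge0 Fi xs (fun=> x0).
have D0 := inner_ge0 (x0 - xs).
have f0 := inner_ge0 (F xs).
have K1 : 1 <= K%:R :> R by rewrite ler1n.
rewrite /B; move: (sigma2 _ _ _) (inner (x0 - xs) _) (inner (F xs) _) S0 D0 f0.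
move=> S D f S0 D0 f0.
(* With denominators cleared, both sides are compared monomial by monomial; the excess is a
   nonnegative combination of [p1] to [p8]. *)
have -> : (3 * B0 / (2 * gamma * K%:R) + 8 * gamma * l ^+ 2 * Om ^+ 2 / K%:R
    + (12 * lhat + l) * D / K%:R
    + (4 + (12 * lhat + l) * gamma) * (2 * n%:R * gamma * S / K%:R)
    + 9 * gamma * f) * (2 * gamma * K%:R) =
    3 * B0 + 16 * (gamma ^+ 2 * (l ^+ 2 * Om ^+ 2))
    + 2 * gamma * (12 * lhat + l) * D
    + (4 + (12 * lhat + l) * gamma) * (4 * (n%:R * gamma ^+ 2 * S))
    + 18 * gamma ^+ 2 * K%:R * f.
  by field; rewrite !gt_eqF.
have g2 := sqr_ge0 gamma.
have [g0 l0 lh0] : [/\ 0 <= gamma, 0 <= l & 0 <= lhat] by split; exact: ltW.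
have p1 : 0 <= gamma ^+ 2 * (l ^+ 2 * Om ^+ 2).
  exact: mulr_ge0 g2 (mulr_ge0 (sqr_ge0 l) (sqr_ge0 Om)).
have p2 : 0 <= gamma * lhat * D := mulr_ge0 (mulr_ge0 g0 lh0) D0.
have p3 : 0 <= gamma * l * D := mulr_ge0 (mulr_ge0 g0 l0) D0.
have p4 : 0 <= n%:R * gamma ^+ 2 * S.
  exact: mulr_ge0 (mulr_ge0 (ler0n R n) g2) S0.
have p5 : 0 <= lhat * gamma * (n%:R * gamma ^+ 2 * S).
  exact: mulr_ge0 (mulr_ge0 lh0 g0) p4.
have p6 : 0 <= l * gamma * (n%:R * gamma ^+ 2 * S).
  exact: mulr_ge0 (mulr_ge0 l0 g0) p4.
have p8 : 0 <= gamma ^+ 2 * f := mulr_ge0 g2 f0.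
(* As [K >= 1], the [4 * gamma ^+ 2 * f] coming from [B] fits into the terms proportional to [K]. *)
have p7 : 0 <= gamma ^+ 2 * f * (K%:R - 1).
  by apply: mulr_ge0 p8 _; rewrite subr_ge0.
lra.
Qed.
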